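(* Let $p$ be a prime, let $S$ be a finite $p$-group, and let $\mathcal F$ be a fusion system on $S$ such that for every subgroup $Q\le S$ one has $$\frac{|S|}{|\mathrm{Hom}_{\mathcal F}(Q,S)|\,|C_S(Q)|}\in\mathbb Z_{(p)}.$$ Let $P\le S$. (a) The number $f_{\mathcal F}(P)$ of $S$-conjugacy classes of fully $\mathcal F$-normalized subgroups of $S$ that are $\mathcal F$-isomorphic to $P$ is not divisible by $p$. (b) The subgroup $P$ is fully $\mathcal F$-normalized if and only if $P$ is fully $\mathcal F$-centralized and $\mathrm{Aut}_S(P)\in\mathrm{Syl}_p(\mathrm{Aut}_{\mathcal F}(P))$.
   Context: A fusion system on $S$ is a category $\mathcal F$ whose objects are the subgroups of $S$, with composition the usual composition of maps, such that (i) $\mathrm{Hom}_S(P,Q)\subseteq\mathrm{Hom}_{\mathcal F}(P,Q)\subseteq\mathrm{Inj}(P,Q)$ for all $P,Q\le S$, where $\mathrm{Hom}_S(P,Q)$ is the set of homomorphisms induced by conjugation with elements of $S$ and $\mathrm{Inj}(P,Q)$ the set of injective homomorphisms; (ii) if $\phi\in\mathrm{Hom}_{\mathcal F}(P,Q)$ then the isomorphism $P\to\phi(P)$ and its inverse are morphisms in $\mathcal F$. The fusion system is not assumed to be saturated. $P$ and $Q$ are $\mathcal F$-isomorphic ($P=_{\mathcal F}Q$) if they are isomorphic in $\mathcal F$. $P$ is fully $\mathcal F$-centralized (resp. fully $\mathcal F$-normalized) if $|C_S(Q)|\le|C_S(P)|$ (resp. $|N_S(Q)|\le|N_S(P)|$)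 for every $Q\le S$ with $Q=_{\mathcal F}P$. $\mathrm{Aut}_S(P)=\mathrm{Hom}_S(P,P)$, $\mathrm{Aut}_{\mathcal F}(P)=\mathrm{Hom}_{\mathcal F}(P,P)$. $\mathbb Z_{(p)}\subset\mathbb Q$ is the localization of $\mathbb Z$ at the prime ideal $(p)$. *)

(* Defs.v *)
From mathcomp Require Import all_boot all_order all_algebra.
From mathcomp Require Import all_fingroup all_solvable.

Set Implicit Arguments.
Unset Strict Implicit.
Unset Printing Implicit Defensive.

Import GroupScope.

(* A map defined on a subgroup P is encoded as a finite function on the
   ambient type that takes the value 1 outside P.  Homomorphisms send 1 to 1,
   so this encoding is stable under plain composition. *)
Section Maps.

Variable gT : finGroupType.
Implicit Types (P Q S : {group gT}) (f g : {ffun gT -> gT}).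

Definition resf P (f : gT -> gT) : {ffun gT -> gT} :=
  [ffun x => if x \in P then f x else 1].

Definition idf P : {ffun gT -> gT} := resf P id.

Definition compf g f : {ffun gT -> gT} := [ffun x => g (f x)].

Definition Inj P Q : {set {ffun gT -> gT}} :=
  [set f | [&& f \in pffun_on 1 (mem P) (mem Q), morphic P f
             & dinjectiveb f (mem P)]].

Definition HomS S P Q : {set {ffun gT -> gT}} :=
  [set resf P (conjg^~ s) | s in S & P :^ s \subset Q].

(* The value of Hom_F on groups that are not subgroups of S is junk: only the
   subgroups of S are objects.  The identities are in HomS. *)
Record fusion_system S := FusionSystem {
  HomF :> {group gT} -> {group gT} -> {set {ffun gT -> gT}};
  HomF_comp : forall P Q R : {group gT}, P \subset S -> Q \subset S -> R \subset S ->
      forall f g, f \in HomF P Q -> g \in HomF Q R -> compf g f \in HomF P R;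
  HomS_subF : forall P Q, P \subset S -> Q \subset S -> HomS S P Q \subset HomF P Q;
  HomF_Inj : forall P Q, P \subset S -> Q \subset S -> HomF P Q \subset Inj P Q;
  HomF_image : forall P Q, P \subset S -> Q \subset S ->
      forall f, f \in HomF P Q ->
      forall R : {group gT}, R = f @: P :> {set gT} ->
      f \in HomF P R /\
      exists2 g, g \in HomF R P & compf g f = idf P /\ compf f g = idf R
}.

(* Sylow theory needs automorphisms as a group, so endomorphisms of P in a set
   H of maps are viewed as permutations in Aut P, which fix every element
   outside P. *)
Definition aut_in (H : {set {ffun gT -> gT}}) P : {set {perm gT}} :=
  [set a in Aut P | resf P a \in H].

Definition AutS S P := aut_in (HomS S P P) P.

Definition AutF S (F : fusion_system S) P := aut_in (F P P) P.

Definition isoF S (F : fusion_system S) P Q :=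
  [exists f in F P Q, [exists g in F Q P,
     (compf g f == idf P) && (compf f g == idf Q)]].

Definition fully_centralized S (F : fusion_system S) P :=
  [forall Q : {group gT}, (Q \subset S) && isoF F P Q ==>
     (#|'C_S(Q)| <= #|'C_S(P)|)%N].

Definition fully_normalized S (F : fusion_system S) P :=
  [forall Q : {group gT}, (Q \subset S) && isoF F P Q ==>
     (#|'N_S(Q)| <= #|'N_S(P)|)%N].

Definition fully_normalized_isos S (F : fusion_system S) P :
    {set {group gT}} :=
  [set Q : {group gT} | [&& Q \subset S, isoF F P Q & fully_normalized F Q]].

Definition nb_fully_normalized_classes S (F : fusion_system S) P : nat :=
  #|[set orbit 'JG%act S Q | Q in fully_normalized_isos F P]|.

Lemma HomS_id S P : idf P \in HomS S P P.
Proof.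
apply/imsetP; exists 1; first by rewrite inE group1 conjsg1 subxx.
by apply/ffunP=> x; rewrite !ffunE conjg1.
Qed.

Lemma HomS_comp S P Q R f g :
  f \in HomS S P Q -> g \in HomS S Q R -> compf g f \in HomS S P R.
Proof.
case/imsetP=> s /[!inE] /andP[Ss sPQ] -> /imsetP[t /[!inE] /andP[St sQR] ->].
apply/imsetP; exists (s * t).
  by rewrite !inE groupM //= conjsgM (subset_trans _ sQR) // conjSg.
apply/ffunP=> x; rewrite !ffunE; case Px: (x \in P).
  by rewrite (subsetP sPQ) ?memJ_conjg // conjgM.
by rewrite group1 conj1g.
Qed.

Lemma group_set_aut_in (H : {set {ffun gT -> gT}}) P :
    idf P \in H -> {in H &, forall f g, compf g f \in H} ->
  group_set (aut_in H P).
Proof.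
move=> H1 HM; apply/group_setP; split.
  apply/setIdP; rewrite group1; split=> //; suff -> : resf P (1 : {perm gT}) = idf P by [].
  by apply/ffunP=> x; rewrite !ffunE perm1.
move=> a b /setIdP[Aa Ha] /setIdP[Ab Hb].
apply/setIdP; split; first exact: groupM.
suff -> : resf P (a * b : {perm gT}) = compf (resf P b) (resf P a) by apply: HM.
apply/ffunP=> x; rewrite !ffunE permM; case Px: (x \in P).
  by rewrite Aut_closed.
by rewrite group1 -(autmE Ab) morph1.
Qed.

Lemma group_set_AutS S P : group_set (AutS S P).
Proof.
apply: group_set_aut_in; first exact: HomS_id.
by move=> f g; apply: HomS_comp.
Qed.

Canonical AutS_group S P := Group (group_set_AutS S P).

Lemma group_set_AutF S (F : fusion_system S) P :
  P \subset S -> group_set (AutF F P).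
Proof.
move=> sPS; apply: group_set_aut_in => [|f g].
  exact: subsetP (HomS_subF F sPS sPS) _ (HomS_id S P).
exact: HomF_comp.
Qed.

Definition AutF_group S (F : fusion_system S) P (sPS : P \subset S) :=
  Group (group_set_AutF F sPS).

(* aut_in H P is a faithful copy of H. *)
Lemma resf_aut_in (H : {set {ffun gT -> gT}}) P :
  H \subset Inj P P -> [set resf P a | a : {perm gT} in aut_in H P] = H.
Proof.
move=> sHI; apply/setP=> f; apply/imsetP/idP=> [[a /setIdP[_ Ha] ->] //|].
move=> Hf; have:= subsetP sHI f Hf; rewrite inE => /and3P[Pf mf /dinjectiveP If].
have fP x : x \in P -> f x \in P.
  by move=> Px; have/familyP/(_ x) := Pf; rewrite Px.
have f1 x : x \notin P -> f x = 1.
  by have/familyP/(_ x) := Pf; case: ifPn => // _ /eqP.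
have inj_f : {in P &, injective f} by [].
have imf : f @: P = P.
  by apply/eqP; rewrite eqEcard card_in_imset ?leqnn ?andbT //;
     apply/subsetP=> _ /imsetP[x Px ->]; exact: fP.
have injm_f : 'injm (morphm_morphism mf) by apply/injmP.
have imfm : morphm_morphism mf @* P = P by rewrite morphimEdom.
exists (aut injm_f imfm).
  apply/setIdP; rewrite Aut_aut; split=> //; suff -> : resf P (aut injm_f imfm) = f by [].
  by apply/ffunP=> x; rewrite ffunE; case: ifPn => [/autE-> //|/f1].
by apply/ffunP=> x; rewrite ffunE; case: ifPn => [Px|/f1 //]; rewrite autE.
Qed.

Lemma resf_Aut_inj P : {in Aut P &, injective (fun a : {perm gT} => resf P a)}.
Proof.
move=> a b Aa Ab /ffunP eab; apply: eq_Aut Aa Ab _ => x Px.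
by have:= eab x; rewrite !ffunE Px.
Qed.

End Maps.

Import GRing.Theory.
Local Open Scope ring_scope.

Definition Zloc (p : nat) (r : rat) : Prop :=
  exists a b : int, ~~ (p%:Z %| b)%Z /\ r = a%:~R / b%:~R.

(* Main.v *)
Require Import Defs.
From mathcomp Require Import all_boot all_order all_algebra.
From mathcomp Require Import all_fingroup all_solvable.
From mathcomp Require Import zify.

(** Write [a = |Aut_F(P)|], let [C] be the F-isomorphism class of [P], and let
    [v] be the p-adic valuation.  For [Q] in [C] the set [Hom_F(Q, S)] is the
    disjoint union of the sets [Iso_F(Q, R)] over [R] in [C], so it has
    [a |C|] elements and the hypothesis reads
    [v(a) + v(|C|) + v(|C_S(Q)|) <= v(|S|)].  Let [p^m] be the largest order of
    a normalizer [N_S(Q)], [Q] in [C].  Counting [C] by [S]-orbits gives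
    [|C| = (|S| / p^m) (f + p t)], so [v(|C|) >= v(|S|) - m], with equality iff
    [p] does not divide [f].  Since [Aut_S(Q)] has order [|N_S(Q) : C_S(Q)|],
    [v(a) >= v(|N_S(Q)|) - v(|C_S(Q)|)], with equality iff [Aut_S(Q)] is Sylow.
    Adding these for a fully normalized [Q] forces equality everywhere, and
    both claims follow. *)

Set Implicit Arguments.
Unset Strict Implicit.
Unset Printing Implicit Defensive.

Import GroupScope GRing.Theory.

(** Clearing denominators gives [m * |b| = |a| * (h * c)] in the naturals. Since [p] does not divide
    [b], the valuation of [m] exceeds that of [h * c] by exactly that of [|a|]. *)
Lemma Zloc_logn_leq (p m h c : nat) : prime p ->
    (0 < m)%N -> (0 < h)%N -> (0 < c)%N -> Zloc p (m%:R / (h%:R * c%:R))%R ->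
  (logn p h + logn p c <= logn p m)%N.
Proof.
move=> p_pr m0 h0 c0 [a [b [pb E]]].
have b0 : b != 0%R by apply: contraNneq pb => ->; rewrite dvdz0.
have Eint : (m%:Z * b = a * (h * c)%N%:Z)%R.
  apply: (@intr_inj rat); rewrite PoszM !rmorphM /=.
  move/eqP: E.
  rewrite eqr_div ?intr_eq0 ?mulf_neq0 ?Num.Theory.pnatr_eq0 -?lt0n //.
  by move/eqP.
have {}E : (m * `|b| = `|a| * (h * c))%N.
  by have := congr1 absz Eint; rewrite !abszM.
have b0' : (0 < `|b|)%N by rewrite absz_gt0.
have a0 : (0 < `|a|)%N.
  rewrite lt0n; apply: contra_eq_neq E => ->.
  by rewrite mul0n -lt0n muln_gt0 m0.
have := congr1 (logn p) E; rewrite !lognM ?muln_gt0 ?h0 //.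
have pbN : (p %| `|b|)%N = false := negbTE pb.
rewrite [logn p `|b|]lognE pbN !andbF.
by rewrite addn0 => ->; apply: leq_addl.
Qed.

Section FusionSystem.

Variables (gT : finGroupType) (S : {group gT}) (F : fusion_system S).
Implicit Types P Q R : {group gT}.

(** * Morphisms of [F] and F-isomorphism *)

Lemma HomF_sub P Q f x : P \subset S -> Q \subset S ->
  f \in F P Q -> x \in P -> f x \in Q.
Proof.
move=> sP sQ /(subsetP (HomF_Inj F sP sQ)); rewrite inE => /and3P[Pf _ _] Px.
by have/familyP/(_ x) := Pf; rewrite Px.
Qed.

Lemma HomF_out P Q f x : P \subset S -> Q \subset S ->
  f \in F P Q -> x \notin P -> f x = 1.
Proof.
move=> sP sQ /(subsetP (HomF_Inj F sP sQ)); rewrite inE => /and3P[Pf _ _] Px.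
by have/familyP/(_ x) := Pf; rewrite (negbTE Px) => /eqP.
Qed.

Lemma HomF_injective P Q f : P \subset S -> Q \subset S ->
  f \in F P Q -> {in P &, injective f}.
Proof.
move=> sP sQ /(subsetP (HomF_Inj F sP sQ)).
by rewrite inE => /and3P[_ _ /dinjectiveP].
Qed.

Lemma HomF_morph P Q f : P \subset S -> Q \subset S ->
  f \in F P Q -> {in P &, {morph f : x y / x * y}}.
Proof.
move=> sP sQ /(subsetP (HomF_Inj F sP sQ)).
by rewrite inE => /and3P[_ /morphicP].
Qed.

Lemma HomF_gen_image P Q f : P \subset S -> Q \subset S -> f \in F P Q ->
  <<f @: P>> = f @: P.
Proof.
move=> sP sQ Ff; apply/gen_set_id/group_setP; have fM := HomF_morph sP sQ Ff.
have f1 : f 1 = 1 by apply: (mulgI (f 1)); rewrite -fM // !mulg1.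
split; first by apply/imsetP; exists 1.
move=> _ _ /imsetP[x Px ->] /imsetP[y Py ->].
by rewrite -fM // imset_f ?groupM.
Qed.

Lemma HomF_image_eq P Q f : P \subset S -> Q \subset S -> #|P| = #|Q| ->
  f \in F P Q -> f @: P = Q.
Proof.
move=> sP sQ cPQ Ff; apply/eqP; rewrite eqEcard.
rewrite card_in_imset; last exact: HomF_injective Ff.
rewrite cPQ leqnn andbT; apply/subsetP=> _ /imsetP[x Px ->].
exact: HomF_sub Ff Px.
Qed.

(** Compose with the inclusion of [Q] into [R], which is conjugation by 1 and so lies in [HomS]. *)
Lemma HomF_widen P Q R f : P \subset S -> Q \subset S -> R \subset S ->
  Q \subset R -> f \in F P Q -> f \in F P R.
Proof.
move=> sP sQ sR sQR Ff.
have FQR : idf Q \in F Q R.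
  apply: (subsetP (HomS_subF F sQ sR)); apply/imsetP; exists 1.
    by rewrite inE group1 conjsg1.
  by apply/ffunP=> x; rewrite !ffunE conjg1.
suff -> : f = compf (idf Q) f by apply: HomF_comp FQR.
apply/ffunP=> x; rewrite !ffunE; case: (boolP (x \in P)) => Px.
  by rewrite (HomF_sub sP sQ Ff).
by rewrite (HomF_out sP sQ Ff Px) group1.
Qed.

Lemma isoFP P Q :
  reflect (exists f g, [/\ f \in F P Q, g \in F Q P,
             compf g f = idf P & compf f g = idf Q]) (isoF F P Q).
Proof.
apply: (iffP exists_inP) => [[f Ff /exists_inP[g Fg /andP[/eqP gf /eqP fg]]]|].
  by exists f, g.
case=> f [g [Ff Fg gf fg]]; exists f => //; apply/exists_inP; exists g => //.
by rewrite gf fg !eqxx.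
Qed.

Lemma compf_idK P (f g : {ffun gT -> gT}) :
  compf g f = idf P -> {in P, cancel f g}.
Proof. by move=> gf x Px; have /ffunP/(_ x) := gf; rewrite !ffunE Px. Qed.

Lemma isoF_refl P : P \subset S -> isoF F P P.
Proof.
move=> sP; have Fid := subsetP (HomS_subF F sP sP) _ (HomS_id S P).
have idM : compf (idf P) (idf P) = idf P.
  by apply/ffunP=> x; rewrite !ffunE; case: (boolP (x \in P)) => [->|_] //;
     rewrite group1.
by apply/isoFP; exists (idf P), (idf P).
Qed.

Lemma isoF_sym P Q : isoF F P Q -> isoF F Q P.
Proof. by case/isoFP=> f [g [? ? ? ?]]; apply/isoFP; exists g, f. Qed.

Lemma isoF_trans P Q R : P \subset S -> Q \subset S -> R \subset S ->
  isoF F P Q -> isoF F Q R -> isoF F P R.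
Proof.
move=> sP sQ sR /isoFP[f [g [Ff Fg gf fg]]] /isoFP[h [k [Fh Fk kh hk]]].
apply/isoFP; exists (compf h f), (compf g k); split.
- exact: HomF_comp Fh.
- exact: HomF_comp Fg.
- rewrite -gf; apply/ffunP=> x; rewrite !ffunE; case: (boolP (x \in P)) => Px.
    by rewrite (compf_idK kh) // (HomF_sub sP sQ Ff).
  by rewrite (HomF_out sP sQ Ff Px) (compf_idK kh).
- rewrite -hk; apply/ffunP=> x; rewrite !ffunE; case: (boolP (x \in R)) => Rx.
    by rewrite (compf_idK fg) // (HomF_sub sR sQ Fk).
  by rewrite (HomF_out sR sQ Fk Rx) (compf_idK fg).
Qed.

Lemma isoF_card P Q : P \subset S -> Q \subset S -> isoF F P Q -> #|P| = #|Q|.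
Proof.
have le (A B : {group gT}) :
    A \subset S -> B \subset S -> isoF F A B -> (#|A| <= #|B|)%N.
  move=> sA sB /isoFP[f [_ [Ff _ _ _]]].
  rewrite -(card_in_imset (HomF_injective sA sB Ff)) subset_leq_card //.
  by apply/subsetP=> _ /imsetP[x Ax ->]; apply: HomF_sub Ff Ax.
by move=> sP sQ iPQ; apply/eqP; rewrite eqn_leq !le // isoF_sym.
Qed.

Lemma isoF_conj P s : P \subset S -> s \in S -> isoF F P (P :^ s)%G.
Proof.
move=> sP Ss; have sPs : P :^ s \subset S by rewrite -(conjGid Ss) conjSg.
apply/isoFP; exists (resf P (conjg^~ s)), (resf (P :^ s) (conjg^~ s^-1)); split.
- apply: (subsetP (HomS_subF F sP sPs)); apply/imsetP; exists s => //.
  by rewrite inE Ss /=.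
- apply: (subsetP (HomS_subF F sPs sP)); apply/imsetP; exists s^-1 => //.
  by rewrite inE groupV Ss /= conjsgK.
- apply/ffunP=> x; rewrite !ffunE; case: (boolP (x \in P)) => Px.
    by rewrite memJ_conjg Px conjgK.
  by rewrite group1 conj1g.
- apply/ffunP=> x; rewrite !ffunE; case: (boolP (x \in P :^ s)) => Px.
    by rewrite -mem_conjg Px conjgKV.
  by rewrite group1 conj1g.
Qed.

(** Transport [u] to [h u g] along the two isomorphisms; cancelling [g] and [h] shows that this is
    injective. *)
Lemma leq_card_HomF_iso P Q P' Q' :
    P \subset S -> Q \subset S -> P' \subset S -> Q' \subset S ->
  isoF F P P' -> isoF F Q Q' -> (#|F P Q| <= #|F P' Q'|)%N.
Proof.
move=> sP sQ sP' sQ' /isoFP[f [g [Ff Fg gf fg]]] /isoFP[h [k [Fh Fk kh hk]]].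
rewrite -(@card_in_imset _ _ (fun u => compf h (compf u g))).
  apply/subset_leq_card/subsetP=> _ /imsetP[u Fu ->].
  exact: (HomF_comp sP' sQ sQ' (HomF_comp sP' sP sQ Fg Fu) Fh).
move=> u v Fu Fv /ffunP E; apply/ffunP=> x.
case: (boolP (x \in P)) => Px; last first.
  by rewrite (HomF_out _ _ Fu) ?(HomF_out _ _ Fv).
have := E (f x); rewrite !ffunE (compf_idK gf) //.
by apply: (can_in_inj (compf_idK kh)); apply: HomF_sub Px.
Qed.

Lemma card_HomF_iso P Q P' Q' :
    P \subset S -> Q \subset S -> P' \subset S -> Q' \subset S ->
  isoF F P P' -> isoF F Q Q' -> #|F P Q| = #|F P' Q'|.
Proof.
by move=> *; apply/eqP; rewrite eqn_leq !leq_card_HomF_iso // isoF_sym.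
Qed.

(** * Counting morphisms over an isomorphism class *)

Definition isoF_class P : {set {group gT}} :=
  [set Q : {group gT} | (Q \subset S) && isoF F P Q].

(** Sort the morphisms from [Q] to [S] by their image [R], which lies in the class. The fibre over
    [R] is [F Q R], because [#|Q| = #|R|] makes every such morphism onto; transport gives it the
    size of [F P P]. *)
Lemma card_HomF P Q : P \subset S -> Q \in isoF_class P ->
  #|F Q S| = (#|isoF_class P| * #|F P P|)%N.
Proof.
move=> sP; rewrite inE => /andP[sQ iPQ].
(* The generated subgroup makes [im] group-valued on all functions; on morphisms it is just the
   image. *)
pose im (f : {ffun gT -> gT}) := <<[set f x | x in Q]>>%G.
rewrite -sum1_card (partition_big im (mem (isoF_class P))) /=; last first.
  move=> f Ff; have E := HomF_gen_image sQ (subxx S) Ff.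
  have [FfR [g Fg [gf fg]]] := HomF_image sQ (subxx S) Ff E.
  have sR : <<f @: Q>> \subset S.
    by rewrite E; apply/subsetP=> _ /imsetP[x Qx ->]; apply: HomF_sub Ff Qx.
  rewrite inE /= sR; apply: isoF_trans iPQ _ => //.
  by apply/isoFP; exists f, g.
rewrite -sum_nat_const; apply: eq_bigr => R; rewrite inE => /andP[sR iPR].
have cQR : #|Q| = #|R| by rewrite -(isoF_card sP sQ) // (isoF_card sP sR).
rewrite -(card_HomF_iso sQ sR sP sP (isoF_sym iPQ) (isoF_sym iPR)) -sum1_card.
apply: eq_bigl => f; apply/andP/idP=> [[Ff /eqP ER]|Ff].
  have E := HomF_gen_image sQ (subxx S) Ff.
  by have [] := HomF_image sQ (subxx S) Ff E; rewrite -/(im f) ER.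
split; first exact: HomF_widen Ff.
apply/eqP/val_inj; rewrite /= (HomF_gen_image sQ sR Ff).
exact: HomF_image_eq Ff.
Qed.

(** * Orders of the automorphism groups *)

Lemma card_AutF P : P \subset S -> #|AutF F P| = #|F P P|.
Proof.
move=> sP; rewrite -[in RHS](resf_aut_in (HomF_Inj F sP sP)).
rewrite card_in_imset //.
by move=> a b /setIdP[Aa _] /setIdP[Ab _]; apply: resf_Aut_inj.
Qed.

(** As a morphic image of ['N_S(P)] with kernel ['C_S(P)], the group [AutS S P] gets both its order
    and, when [S] is a p-group, its p-group property. *)
Lemma AutS_conj_aut P : AutS S P = conj_aut P @* 'N_S(P).
Proof.
rewrite morphimEsub ?subsetIr //; apply/setP=> a; apply/setIdP/imsetP.
  case=> Aa /imsetP[s]; rewrite inE => /andP[Ss sPs] /ffunP E.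
  have Ns : s \in 'N(P) by rewrite inE.
  exists s; first by rewrite inE Ss.
  apply: (eq_Aut Aa (Aut_aut _ _)) => x Px.
  by rewrite norm_conj_autE //; have := E x; rewrite !ffunE Px.
case=> s /setIP[Ss Ns] ->; split; first exact: Aut_aut.
apply/imsetP; exists s; first by rewrite inE Ss (normP Ns) subxx.
by apply/ffunP=> x; rewrite !ffunE; case: ifP => // Px; rewrite norm_conj_autE.
Qed.

Lemma card_AutS P : (#|AutS S P| * #|'C_S(P)|)%N = #|'N_S(P)|.
Proof.
have E : 'N_S(P) :&: 'C(P) = 'C_S(P).
  by rewrite -setIA (setIidPr (cent_sub P)).
rewrite AutS_conj_aut card_morphim ker_conj_aut (setIidPr (subsetIr _ _)).
by rewrite -indexgI E mulnC Lagrange // setIS ?cent_sub.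
Qed.

Lemma AutS_sub_AutF P : P \subset S -> AutS S P \subset AutF F P.
Proof.
move=> sP; apply/subsetP=> a /setIdP[Aa Ha]; apply/setIdP; split=> //.
exact: (subsetP (HomS_subF F sP sP)).
Qed.

(** * Fully normalized members of a class, and the action of [S] on it *)

Lemma fully_normalizedP P Q : P \subset S -> Q \in isoF_class P ->
  reflect {in isoF_class P, forall R, #|'N_S(R)| <= #|'N_S(Q)|}%N
          (fully_normalized F Q).
Proof.
move=> sP; rewrite inE => /andP[sQ iPQ]; apply: (iffP forall_inP) => H R.
  rewrite inE => /andP[sR iPR]; apply: H; rewrite sR.
  exact: isoF_trans (isoF_sym iPQ) iPR.
case/andP=> sR iQR; apply: H; rewrite inE sR.
exact: isoF_trans iPQ iQR.
Qed.

Lemma exists_fully_normalized P : P \subset S ->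
  exists2 Q, Q \in isoF_class P & fully_normalized F Q.
Proof.
move=> sP; have PP : P \in isoF_class P by rewrite inE sP isoF_refl.
have [Q PQ maxQ] :=
  @arg_maxnP _ P (mem (isoF_class P)) (fun Q => #|'N_S(Q)|) PP.
by exists Q; [exact: PQ | apply/(fully_normalizedP sP PQ)].
Qed.

Lemma acts_isoF_class P : P \subset S ->
  [acts S, on isoF_class P | 'JG].
Proof.
move=> sP; apply/actsP=> s Ss Q.
have sub (R : {group gT}) t : t \in S -> R \in isoF_class P ->
      (R :^ t)%G \in isoF_class P.
  move=> St; rewrite !inE => /andP[sR iPR].
  have sRt : R :^ t \subset S by rewrite -(conjGid St) conjSg.
  by rewrite sRt; apply: isoF_trans sP sR sRt iPR (isoF_conj sR St).
apply/idP/idP=> [H|]; last exact: sub.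
have <- : ((Q :^ s) :^ s^-1)%G = Q by apply/val_inj; rewrite /= conjsgK.
exact: sub (groupVr Ss) H.
Qed.

Lemma card_orbitJG Q : #|orbit 'JG S Q| = #|S : 'N_S(Q)|.
Proof. by rewrite card_orbit astab1JG. Qed.

Lemma fully_normalized_isosE P : fully_normalized_isos F P =
  [set Q in isoF_class P | fully_normalized F Q].
Proof. by apply/setP=> Q; rewrite !inE andbA. Qed.

(** * Orbit counting and valuations in the p-group [S] *)

Variables (p : nat) (p_pr : prime p) (pS : p.-group S).

Lemma logn_index_normalizer Q :
  (logn p #|S : 'N_S(Q)| + logn p #|'N_S(Q)| = logn p #|S|)%N.
Proof. by rewrite -lognM // mulnC Lagrange ?subsetIl. Qed.

(** Both indices are powers of [p], so the strictly larger one has at least one more factor [p]. *)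
Lemma dvdn_index_normalizer Q R : (#|'N_S(R)| < #|'N_S(Q)|)%N ->
  (p * #|S : 'N_S(Q)| %| #|S : 'N_S(R)|)%N.
Proof.
have cN (A : {group gT}) : #|S : 'N_S(A)| =
    (p ^ (logn p #|S| - logn p #|'N_S(A)|))%N.
  rewrite -(logn_index_normalizer A) addnK -p_part part_pnat_id //.
  exact: pnat_dvd (dvdn_indexg _ _) pS.
rewrite [X in (X < _)%N](card_pgroup (pgroupS (subsetIl S 'N(R)) pS)).
rewrite [X in (_ < X)%N](card_pgroup (pgroupS (subsetIl S 'N(Q)) pS)).
rewrite ltn_exp2l ?prime_gt1 // => lt; rewrite !cN -expnS dvdn_exp2l //.
(* Truncated subtraction is strict here because the valuation of ['N_S(R)] is below that of [S]. *)
by rewrite ltn_sub2l // (leq_trans lt) // dvdn_leq_log ?cardSg ?subsetIl.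
Qed.

(** Orbits of fully normalized subgroups all have length [#|S : 'N_S(Q)|]. The remaining orbits have
    smaller normalizers, so their lengths are multiples of [p] times that index. *)
Lemma card_isoF_class P Q : P \subset S -> Q \in isoF_class P ->
    fully_normalized F Q ->
  exists t, #|isoF_class P| =
    (#|S : 'N_S(Q)| * (nb_fully_normalized_classes F P + p * t))%N.
Proof.
move=> sP PQ nQ; have maxQ := fully_normalizedP sP PQ nQ.
rewrite -(acts_sum_card_orbit (acts_isoF_class sP)).
rewrite (bigID (mem [set orbit 'JG%act S R | R in fully_normalized_isos F P])) /=.
have sub : fully_normalized_isos F P \subset isoF_class P.
  by rewrite fully_normalized_isosE; apply/subsetP=> R /setIdP[].
have -> : (\sum_(T in [set orbit 'JG%act S R | R in isoF_class P] |
    T \in [set orbit 'JG%act S R | R in fully_normalized_isos F P]) #|T| =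
    nb_fully_normalized_classes F P * #|S : 'N_S(Q)|)%N.
  rewrite -sum_nat_const; apply: eq_big => [T|T /andP[_ /imsetP[R NR ->]]].
    by apply/andb_idl=> TN; apply: (subsetP (imsetS _ sub)).
  have := NR; rewrite fully_normalized_isosE => /setIdP[PR nR].
  have maxR := fully_normalizedP sP PR nR.
  rewrite card_orbitJG -!divgS ?subsetIl //; congr (_ %/ _)%N.
  by apply/eqP; rewrite eqn_leq maxQ ?maxR.
have /dvdnP[t ->] : (p * #|S : 'N_S(Q)| %|
    \sum_(T in [set orbit 'JG%act S R | R in isoF_class P] |
    T \notin [set orbit 'JG%act S R | R in fully_normalized_isos F P]) #|T|)%N.
  apply: dvdn_sum => T /andP[/imsetP[R PR ->] nT].
  rewrite card_orbitJG; apply: dvdn_index_normalizer.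
  (* A normalizer of the same order as that of [Q] would make [R] fully normalized and put its orbit
     in the first sum. *)
  rewrite ltn_neqAle maxQ // andbT; apply: contra nT => /eqP eRQ.
  apply: imset_f; rewrite fully_normalized_isosE inE PR.
  by apply/(fully_normalizedP sP PR) => A PA; rewrite eRQ maxQ.
by exists t; lia.
Qed.

Lemma logn_AutS P :
  (logn p #|AutS S P| + logn p #|'C_S(P)| = logn p #|'N_S(P)|)%N.
Proof. by rewrite -card_AutS lognM // (cardG_gt0 (AutS_group S P)). Qed.

Lemma AutS_pgroup P : p.-group (AutS S P).
Proof. by rewrite AutS_conj_aut morphim_pgroup // (pgroupS _ pS) ?subsetIl. Qed.

(** [AutS S P] is a p-subgroup of [AutF F P], so only the exponents of [p] need comparing. *)
Lemma AutS_SylowE P (sPS : P \subset S) :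
  (AutS_group S P \in 'Syl_p(AutF_group F sPS)) =
    (logn p #|AutS S P| == logn p #|AutF F P|).
Proof.
rewrite inE pHallE AutS_sub_AutF //= p_part (card_pgroup (AutS_pgroup P)).
by rewrite pfactorK // eqn_exp2l ?prime_gt1.
Qed.

Hypothesis hF : forall Q : {group gT}, Q \subset S ->
  Zloc p (#|S|%:R / (#|F Q S|%:R * #|'C_S(Q)|%:R))%R.

Lemma logn_isoF_class P Q : P \subset S -> Q \in isoF_class P ->
  (logn p #|isoF_class P| + logn p #|AutF F P| + logn p #|'C_S(Q)|
     <= logn p #|S|)%N.
Proof.
move=> sP PQ; have n0 : (0 < #|isoF_class P|)%N by apply/card_gt0P; exists Q.
have a0 : (0 < #|AutF F P|)%N := cardG_gt0 (AutF_group F sP).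
have h := card_HomF sP PQ; rewrite -(card_AutF sP) in h.
rewrite -lognM // -h; apply: Zloc_logn_leq => //.
  by rewrite h muln_gt0 n0.
by apply: hF; move: PQ; rewrite inE => /andP[].
Qed.

Lemma logn_AutF_class P Q : P \subset S -> Q \in isoF_class P ->
  logn p #|AutF F Q| = logn p #|AutF F P|.
Proof.
move=> sP; rewrite inE => /andP[sQ iPQ].
by rewrite !card_AutF // (card_HomF_iso sP sP sQ sQ).
Qed.

Lemma fully_normalized_tight P Q : P \subset S -> Q \in isoF_class P ->
    fully_normalized F Q ->
  [/\ ~~ (p %| nb_fully_normalized_classes F P)%N,
      logn p #|AutS S Q| = logn p #|AutF F P|
    & {in isoF_class P, forall R, logn p #|'C_S(R)| <= logn p #|'C_S(Q)|}%N].
Proof.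
move=> sP PQ nQ; have [t ht] := card_isoF_class sP PQ nQ.
have n0 : (0 < #|isoF_class P|)%N by apply/card_gt0P; exists Q.
have sQ : Q \subset S by move: PQ; rewrite inE => /andP[].
(* Positivity of [f + p t] matters because [logn p 0 = 0]: valuation zero alone would not exclude
   divisibility by [p]. *)
have := n0; rewrite ht muln_gt0 => /andP[_ f0].
have Eidx := logn_index_normalizer Q; have EN := logn_AutS Q.
have leA : (logn p #|AutS S Q| <= logn p #|AutF F P|)%N.
  rewrite -(logn_AutF_class sP PQ) dvdn_leq_log //.
    exact: cardG_gt0 (AutF_group F sQ).
  exact: (@cardSg _ (AutF_group F sQ) (AutS_group S Q)) (AutS_sub_AutF sQ).
have bound R (PR : R \in isoF_class P) := logn_isoF_class sP PR.
rewrite ht lognM // in bound.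
(* At [Q] the bound reduces to [v(f + p t) + v(a) <= v(|Aut_S(Q)|)], and [leA] is the reverse
   estimate. *)
have bQ := bound Q PQ; split.
- have: logn p (nb_fully_normalized_classes F P + p * t) == 0%N by lia.
  apply: contraL => pf; rewrite -lt0n logn_gt0 mem_primes p_pr f0.
  by rewrite dvdn_add // dvdn_mulr.
- by lia.
(* At [R] the bound gives [v(|C_S(R)|) <= v(|N_S(Q)|) - v(a)], which equals [v(|C_S(Q)|)] by
   tightness at [Q]. *)
- by move=> R /bound bR; lia.
Qed.

Lemma logn_leq_subgroup (A B : {group gT}) : A \subset S -> B \subset S ->
  (#|A| <= #|B|)%N = (logn p #|A| <= logn p #|B|)%N.
Proof.
move=> sA sB; rewrite {1}(card_pgroup (pgroupS sA pS)).
by rewrite {1}(card_pgroup (pgroupS sB pS)) leq_exp2l ?prime_gt1.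
Qed.

Lemma fully_normalized_iff P (sPS : P \subset S) : fully_normalized F P <->
  fully_centralized F P /\ AutS_group S P \in 'Syl_p(AutF_group F sPS).
Proof.
have PP : P \in isoF_class P by rewrite inE sPS isoF_refl.
split=> [nP|[cP sylP]].
  have [_ EA maxC] := fully_normalized_tight sPS PP nP.
  rewrite AutS_SylowE EA eqxx; split=> //; apply/forall_inP=> R PR.
  by rewrite logn_leq_subgroup ?subsetIl // maxC // inE.
(* For the converse, compare [P] with a fully normalized [Q] in its class: the valuations of [AutS]
   agree, and the centralizer of [P] is at least as large, hence so is its normalizer. *)
have [Q PQ nQ] := exists_fully_normalized sPS.
have [_ EA _] := fully_normalized_tight sPS PQ nQ.
apply/(fully_normalizedP sPS PP) => R PR.
apply: leq_trans (fully_normalizedP sPS PQ nQ R PR) _.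
rewrite logn_leq_subgroup ?subsetIl // -!logn_AutS EA.
move: sylP; rewrite AutS_SylowE => /eqP->.
rewrite leq_add2l -logn_leq_subgroup ?subsetIl //.
by apply: (forall_inP cP); move: PQ; rewrite inE.
Qed.

End FusionSystem.

Theorem proposition7p19 (gT : finGroupType) (p : nat) (p_pr : prime p)
    (S : {group gT}) (pS : p.-group S) (F : fusion_system S)
    (hF : forall Q : {group gT}, Q \subset S ->
       Zloc p (#|S|%:R / (#|F Q S|%:R * #|'C_S(Q)|%:R))%R)
    (P : {group gT}) (sPS : P \subset S) :
  ~~ (p %| nb_fully_normalized_classes F P)%N /\
  (fully_normalized F P <->
   fully_centralized F P /\ AutS_group S P \in 'Syl_p(AutF_group F sPS)).
Proof.
split; last exact: fully_normalized_iff.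
have [Q PQ nQ] := exists_fully_normalized F sPS.
by have [] := fully_normalized_tight p_pr pS hF sPS PQ nQ.
Qed.
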